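(* Let $\mathbb{F}\in\{\mathbb{R},\mathbb{C}\}$, let $\mathcal{A}=\{A_e:e\in E\}$ be a finite family of non-trivial linear subspaces of $\mathbb{F}^n$, and let $H$ be a codimension one linear subspace of $\mathbb{F}^n$ that is regular with respect to $\mathcal{A}$. Then \[ \dim\langle A_e\cap H: e\in E\rangle=\min\Big\{\sum_{i=1}^t\big(\dim\langle A_e:e\in F_i\rangle-1\big):\{F_1,\dots,F_t\}\text{ is a partition of }E\Big\}. \]
   Context: A partition of $E$ is a collection of nonempty pairwise disjoint subsets whose union is $E$. $\langle\cdot\rangle$ denotes linear span. A codimension one linear subspace $H\subseteq\mathbb{F}^n$ is regular with respect to $\mathcal{A}$ if (i) $H$ intersects $\mathcal{A}$ transversally, i.e. $\dim(A_e\cap H)=\dim A_e-1$ for all $e\in E$, and (ii) for each $F\subseteq E$, the quantity $\dim\langle A_e\cap H':e\in F\rangle$ is maximized by $H'=H$ over all codimension one linear subspaces $H'$ intersecting $\mathcal{A}$ transversally. *)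

(* Defs.v *)
From mathcomp Require Import all_boot all_order all_algebra.
From mathcomp Require Import reals.
From mathcomp Require Import complex.

Set Implicit Arguments.
Unset Strict Implicit.
Unset Printing Implicit Defensive.

Import GRing.Theory.
Local Open Scope ring_scope.

Variant scalar_kind := RealScalars | ComplexScalars.

(* All realTypes are isomorphic to the field of real numbers. *)
Definition scalar_field (R : realType) (k : scalar_kind) : fieldType :=
  match k with
  | RealScalars => R
  | ComplexScalars => R[i]
  end.

Section Regularity.
Variables (K : fieldType) (n : nat) (E : finType).
Implicit Types (A : E -> {vspace 'rV[K]_n}) (H : {vspace 'rV[K]_n}).

(* Written with a successor because n could be 0, in which case no subspace
   has codimension one. *)
Definition codim1 H : Prop := (\dim H).+1 = n.

Definition transversal_to A H : Prop :=
  forall e, (\dim (A e :&: H)%VS).+1 = \dim (A e).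

Definition regular_wrt A H : Prop :=
  [/\ codim1 H,
      transversal_to A H
    & forall (F : {set E}) (H' : {vspace 'rV[K]_n}),
        codim1 H' -> transversal_to A H' ->
        (\dim (\sum_(e in F) (A e :&: H'))%VS
           <= \dim (\sum_(e in F) (A e :&: H))%VS)%N].

(* When every A e is non-zero and P has no empty block, each dimension below is
   positive, so the truncated subtraction is the integer one. *)
Definition partition_weight A (P : {set {set E}}) : nat :=
  (\sum_(F in P) (\dim (\sum_(e in F) A e)%VS - 1))%N.

End Regularity.

Definition is_min (S : nat -> Prop) (m : nat) : Prop :=
  S m /\ (forall k, S k -> (m <= k)%N).

(* Main.v *)
Require Import Defs.
From mathcomp Require Import all_boot all_order all_algebra.
From mathcomp Require Import reals.
From mathcomp Require Import boolp complex ring.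

Set Implicit Arguments.
Unset Strict Implicit.
Unset Printing Implicit Defensive.

Import GRing.Theory.
Local Open Scope ring_scope.

(* Write H = ker h and L(h) for the span of the A e :&: ker h.  The bound by the
   weight of a partition is immediate, so it is enough to find one transversal
   h for which dim L(h) is the weight of some partition.  Choose h maximizing
   the sum over e, f of dim (A e + A f + L(h)), and put e and f in the same
   block F when A e + L(h) = A f + L(h).  With B F the span of the A e for
   e in F, one gets B F :&: ker h <= L(h), and it remains to see that these
   subspaces are independent.  Otherwise there are v F in B F :&: ker h with
   sum 0, and a functional g which is -1 and 1 on two of them and 0 on the
   others.  For generic t, replacing h by h' = h + t g changes neither the
   dimensions above nor the blocks.  Moving each v F along B F into ker h'
   gives elements of L(h') whose sum is a combination of b and c with nonzero
   coefficients, where b in A e and c in A f, for e and f in the two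
   distinguished blocks; this forces A e + L(h') = A f + L(h'), i.e. e and f
   lie in the same block. *)

Lemma ex_maximizer (T : Type) (Q : T -> Prop) (f : T -> nat) (m : nat) :
  (exists x, Q x) -> (forall x, Q x -> (f x <= m)%N) ->
  exists2 x, Q x & forall y, Q y -> (f y <= f x)%N.
Proof.
move=> [x0 Qx0] fm.
pose S i := `[< exists2 x, Q x & f x = i >].
have exS : exists i, S i by exists (f x0); apply/asboolP; exists x0.
have Sm i : S i -> (i <= m)%N by move=> /asboolP[x Qx <-]; exact: fm.
have [i /asboolP[x Qx <-] maxi] := ex_maxnP exS Sm.
by exists x => // y Qy; apply: maxi; apply/asboolP; exists y.
Qed.

(** * Conditions on a scalar that hold off the roots of a nonzero polynomial *)

Section Generic.
Variable K : fieldType.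
Implicit Type Q : K -> Prop.

(** A polynomial witness survives finite conjunctions by taking products, and a determinant can
    serve as one directly. Over a finite field it may vanish everywhere, so it does not by itself
    provide a good [t]. *)
Definition generic Q :=
  exists2 p : {poly K}, p != 0 & forall t, p.[t] != 0 -> Q t.

Lemma generic_and Q1 Q2 :
  generic Q1 -> generic Q2 -> generic (fun t => Q1 t /\ Q2 t).
Proof.
move=> [p p0 pQ] [q q0 qQ]; exists (p * q); first by rewrite mulf_neq0.
by move=> t; rewrite hornerM mulf_eq0 negb_or => /andP[/pQ ? /qQ].
Qed.

Lemma generic_forall (I : finType) (Q : I -> K -> Prop) :
  (forall i, generic (Q i)) -> generic (fun t => forall i, Q i t).
Proof.
move=> gQ.
have /fin_all_exists[p pP] i :
    exists p : {poly K}, p != 0 /\ forall t, p.[t] != 0 -> Q i t.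
  by have [p] := gQ i; exists p.
exists (\prod_i p i); first by apply/prodf_neq0 => i _; case: (pP i).
move=> t; rewrite horner_prod => /prodf_neq0 pt i.
by case: (pP i) => _; apply; exact: pt.
Qed.

Lemma generic_linear_neq0 (a b : K) :
  a != 0 -> generic (fun t => a + t * b != 0).
Proof.
move=> a0; exists (a%:P + b *: 'X); last by move=> t; rewrite !hornerE mulrC.
apply: contra_neq a0 => /(congr1 (horner^~ 0)).
by rewrite !hornerE.
Qed.

Lemma generic_neq0 : generic (fun t => t != 0).
Proof. by exists 'X; [rewrite polyX_eq0 | move=> t; rewrite hornerX]. Qed.

(* A linear map 1 + t M carries W into Wt t; its determinant is a polynomial
   in t with value 1 at 0, so it is injective for generic t. *)
Lemma generic_dim_affine (n : nat) (W : {vspace 'rV[K]_n})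
    (Wt : K -> {vspace 'rV[K]_n}) :
  (forall w, w \in W -> exists u, forall t, w + t *: u \in Wt t) ->
  generic (fun t => (\dim W <= \dim (Wt t))%N).
Proof.
move=> affW; pose X := vbasis W.
have /fin_all_exists[u uP] (i : 'I_(\dim W)) :
    exists u, forall t, X`_i + t *: u \in Wt t.
  by apply: affW; rewrite vbasis_mem // mem_nth // size_tuple.
(* For [w] in [W], [w *m pinvmx B] lists coefficients of [w] on the rows of [B]; hence [1 + t M]
   sends [w] to the same combination of the vectors assumed to lie in [Wt t]. *)
pose B := \matrix_(i < \dim W) X`_i; pose M := pinvmx B *m \matrix_i u i.
have subB w : w \in W -> (w <= B)%MS.
  move=> /coord_vbasis wE; apply/submxP; exists (\row_i coord X i w).
  by rewrite mulmx_sum_row [LHS]wE; apply: eq_bigr => i _; rewrite rowK mxE.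
pose Mp := 1%:M + 'X *: map_mx polyC M.
have detMp t : (\det Mp).[t] = \det (1%:M + t *: M).
  rewrite -horner_evalE -det_map_mx; congr (\det _).
  by apply/matrixP => i j; rewrite !mxE /= horner_evalE hornerD hornerM hornerX hornerC -polyC_natr hornerC.
exists (\det Mp).
  apply: contra_eq_neq (detMp 0) => ->.
  by rewrite scale0r addr0 det1 horner0 eq_sym oner_neq0.
move=> t; rewrite detMp -unitfE -unitmxE => unitM.
pose f : 'End('rV_n) := linfun (mulmxr (1%:M + t *: M)).
have kerf : lker f == 0%VS.
  by apply/lker0P => x y; rewrite !lfunE; exact: (can_inj (mulmxK unitM)).
rewrite -(@limg_dim_eq _ _ _ f W) ?(eqP kerf) ?capv0 //.
apply/dimvS/subvP => _ /memv_imgP[w wW ->].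
rewrite lfunE /= mulmxDr mulmx1 -scalemxAr mulmxA.
rewrite -[in X in X + _](mulmxKpV (subB _ wW)) scalemxAr -mulmxDr mulmx_sum_row.
by apply: memv_suml => i _; rewrite memvZ // linearD linearZ /= !rowK.
Qed.

End Generic.

(** In characteristic zero the first [size p] naturals are distinct scalars, one more than the
    degree of [p], so they cannot all be roots. *)
Lemma generic_ex (K : numFieldType) (Q : K -> Prop) :
  generic Q -> exists t, Q t.
Proof.
move=> [p p0 pQ]; pose s := [seq i%:R : K | i <- iota 0 (size p)].
have us : uniq s.
  by rewrite map_inj_uniq ?iota_uniq // => i j /eqP; rewrite Num.Theory.eqr_nat => /eqP.
have /allPn[t _ pt] : ~~ all (root p) s.
  by apply/negP => rs; have := max_poly_roots p0 rs us; rewrite size_map size_iota ltnn.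
by exists t; exact: pQ.
Qed.

(** * Linear functionals, their kernels, and independence of subspaces *)

Section Functional.
Variables (K : fieldType) (V : vectType K).
Implicit Types (U X L : {vspace V}) (h : 'Hom(V, K^o)).

(** Projecting along [U] onto a complement kills [U] but not [x]; the functional then reads the
    coordinate along the image of [x]. *)
Lemma separating_functional U (x : V) :
  x \notin U -> exists2 h : 'Hom(V, K^o), U = (U :&: lker h)%VS & h x = 1.
Proof.
move=> xU; pose f := (\1 - projv U)%VF; pose y := f x.
have y0 : y != 0.
  rewrite /y /f add_lfunE opp_lfunE id_lfunE subr_eq0.
  by apply: contraNneq xU => ->; exact: memv_proj.
exists (linfun (coord [tuple y] 0 : V -> K^o) \o f)%VF; last first.
  rewrite comp_lfunE lfunE /=.
  have := @coord_free K V 1 [tuple y] 0 0; rewrite /= seq1_free => -> //.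
apply/esym/capv_idPl/subvP => v vU; rewrite memv_ker comp_lfunE.
by rewrite /f add_lfunE opp_lfunE id_lfunE projv_id // subrr linear0.
Qed.

Lemma dim_cap_lker h U :
  ~~ (U <= lker h)%VS -> (\dim (U :&: lker h)).+1 = \dim U.
Proof.
rewrite lkerE => hU; rewrite -(limg_ker_dim h U) -addn1; congr addn.
apply/esym/eqP; rewrite eqn_leq lt0n dimv_eq0 hU andbT.
by rewrite (leq_trans (dimvS (subvf _))) // dimvf.
Qed.

Lemma unit_vector h U :
  ~~ (U <= lker h)%VS -> exists2 b, b \in U & h b = 1.
Proof.
case/subvPn => b bU; rewrite memv_ker => hb.
by exists ((h b)^-1 *: b); [rewrite memvZ | rewrite linearZ /=; exact: mulVf].
Qed.

Lemma sub_line_lker h U b :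
  b \in U -> h b != 0 -> (U <= <[b]> + (U :&: lker h))%VS.
Proof.
move=> bU hb; apply/subvP => x xU.
rewrite -(subrK ((h x / h b) *: b) x) addrC memv_add ?memvZ ?memv_line //.
rewrite memv_cap memvB ?memvZ //= memv_ker linearB linearZ /=.
by apply/eqP; rewrite [X in _ - X](_ : _ = h x) ?subrr //; exact: mulfVK.
Qed.

(** If [x = u + l] with [h] zero on [x] and on [l], then [h u = 0], so [u] already lies in [L]. *)
Lemma cap_lker_sub h U X L :
  (L <= lker h)%VS -> (U :&: lker h <= L)%VS -> (X <= U + L)%VS ->
  (X :&: lker h <= L)%VS.
Proof.
move=> Lh UL XUL; apply/subvP => x /memv_capP[xX xh].
have /memv_addP[u uU [l lL def_x]] := subvP XUL x xX.
rewrite def_x memvD // (subvP UL) // memv_cap uU /=.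
by rewrite -(addrK l u) -def_x memvB // (subvP Lh).
Qed.

(* The dependency to be excluded is -x = v i against components w k of x in an
   already independent family; h kills all of these but w j. *)
Lemma directv_functional (I : finType) (P : {set I}) (C : I -> {vspace V}) :
  (forall (v : I -> V) i j (h : 'Hom(V, K^o)),
     (forall k, k \in P -> v k \in C k) -> \sum_(k in P) v k = 0 ->
     i \in P -> j \in P -> i != j -> h (v i) = - 1 -> h (v j) = 1 ->
     (forall k, k \in P -> k != i -> k != j -> h (v k) = 0) -> False) ->
  directv (\sum_(k in P) C k).
Proof.
move=> noDep.
suff dirQ m (Q : {set I}) : #|Q| = m -> Q \subset P ->
    directv (\sum_(k in Q) C k) by exact: (dirQ _ P).
elim: m Q => [|m IHm] Q; first by move/cards0_eq->; rewrite directvE /= !big_set0 dimv0.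
move=> cardQ QP; have /card_gt0P[i iQ] : (0 < #|Q|)%N by rewrite cardQ.
have Qi_P : Q :\ i \subset P := subset_trans (subsetDl _ _) QP.
have dirQi : directv (\sum_(k in Q :\ i) C k).
  by apply: IHm => //; apply/eqP; rewrite -eqSS -cardQ (cardsD1 i Q) iQ.
suff capCi : (C i :&: \sum_(k in Q :\ i) C k)%VS = 0%VS.
  rewrite directvE /= !(big_setD1 i iQ) /= dimv_disjoint_sum //.
  by rewrite eqn_add2l -directvE.
apply/eqP; rewrite -vpick0; set x := vpick _.
have /memv_capP[xi /memv_sumP[w wC def_x]] : x \in _ := memv_pick _.
apply: contraT => x0.
have /exists_inP[j jQi wj0] : [exists j in Q :\ i, w j != 0].
  apply: contraNT x0; rewrite negb_exists_in => /forall_inP w0.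
  by rewrite def_x big1 // => k /w0; rewrite negbK => /eqP.
(* Independence over [Q :\ i] keeps the nonzero [w j] out of the span of the other summands, so a
   functional can isolate it. *)
have wjC : w j \notin (\sum_(k in Q :\ i | k != j) C k)%VS.
  apply: contra wj0 => wj; rewrite -memv0 -(directv_sumP dirQi j jQi).
  by rewrite memv_cap wC.
have [h defC hj] := separating_functional wjC.
have hC k : k \in Q :\ i -> k != j -> h (w k) = 0.
  move=> kQ kj; apply/eqP; rewrite -memv_ker.
  have := capvSr (\sum_(k in Q :\ i | k != j) C k)%VS (lker h).
  rewrite -defC => /subvP; apply.
  by apply: (subvP (sumv_sup k _ (subvv _))); rewrite ?kQ ?wC.
have hx : h x = 1.
  rewrite def_x linear_sum /= (bigD1 j) //= hj big1 ?addr0 // => k /andP[].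
  exact: hC.
have [/[!in_setD1]/andP[ji jQ]] := (jQi).
pose v k := if k == i then - x else if k \in Q then w k else 0.
case: (noDep v i j h); rewrite ?(subsetP QP) 1?eq_sym //.
- move=> k kP; rewrite /v; case: eqP => [->|/eqP ki]; first by rewrite memvN.
  by case: ifP => kQ; rewrite ?mem0v // wC // !inE ki.
- rewrite (big_setID Q) /= (setIidPr QP) (big_setD1 i iQ) /= /v eqxx.
  rewrite [X in _ + X]big1 ?addr0 => [|k]; last first.
    by rewrite !inE => /andP[/negPf kQ _]; rewrite kQ; case: eqP kQ => // ->; rewrite iQ.
  apply/eqP; rewrite addrC subr_eq0 def_x; apply/eqP/eq_bigr => k.
  by rewrite !inE => /andP[/negPf-> ->].
- by rewrite /v eqxx linearN /= hx.
- by rewrite /v (negPf ji) jQ.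
- move=> k kP ki kj; rewrite /v (negPf ki); case: ifP => kQ; last exact: linear0.
  by apply: hC => //; rewrite !inE ki.
Qed.

End Functional.

(** * Traces of the family on a hyperplane and their perturbation *)

Section Traces.
Variables (K : fieldType) (n : nat) (E : finType).
Variable A : E -> {vspace 'rV[K]_n}.
Implicit Types (h g : 'Hom('rV[K]_n, K^o)) (e f : E).

Definition trace_span h : {vspace 'rV[K]_n} := (\sum_e (A e :&: lker h))%VS.

Definition crosses h : Prop := forall e, ~~ (A e <= lker h)%VS.

Lemma trace_span_lker h : (trace_span h <= lker h)%VS.
Proof. by apply/subv_sumP => e _; apply: capvSr. Qed.

Lemma trace_sub_span h e : (A e :&: lker h <= trace_span h)%VS.
Proof. exact: (sumv_sup e). Qed.

(** The kernel of [h] cuts [A e + trace_span h] exactly in [trace_span h], and [h] is nonzero on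
    that sum. Thus each [A e] becomes a line modulo [trace_span h]. *)
Lemma dim_add_trace_span h e :
  crosses h -> \dim (A e + trace_span h)%VS = (\dim (trace_span h)).+1.
Proof.
move=> hA; rewrite -(@dim_cap_lker _ _ h); last first.
  by apply: contra (hA e); apply: subv_trans; exact: addvSl.
congr (\dim _).+1; apply/eqP; rewrite eqEsubv.
rewrite (cap_lker_sub (trace_span_lker h) (trace_sub_span h e)) //=.
by rewrite subv_cap addvSr trace_span_lker.
Qed.

Lemma pencilE h g t x : (h + t *: g) x = h x + t * g x.
Proof. by rewrite add_lfunE scale_lfunE. Qed.

Lemma generic_crosses h g :
  crosses h -> generic (fun t => crosses (h + t *: g)).
Proof.
move=> hA; apply: generic_forall => e.
have [b bA hb] := unit_vector (hA e).
have [|p p0 pP] := @generic_linear_neq0 K 1 (g b); first exact: oner_neq0.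
exists p => // t /pP tb; apply/subvPn; exists b => //.
by rewrite memv_ker pencilE hb.
Qed.

(* [v + t (g b v - g v b)] follows [v] into the kernel of [h + t g] when
   [h b = 1]. *)
Lemma generic_dim_span h g e f :
  crosses h ->
  generic (fun t => (\dim (A e + A f + trace_span h)%VS
                       <= \dim (A e + A f + trace_span (h + t *: g)%R)%VS)%N).
Proof.
move=> hA; apply: generic_dim_affine => w.
case/memv_addP=> a aA [_ /memv_sumP[v vA ->] ->].
have /fin_all_exists2[b bA hb] i := unit_vector (hA i).
exists (\sum_i (g (b i) *: v i - g (v i) *: b i)) => t.
rewrite scaler_sumr -addrA -big_split /= memv_add //.
apply: memv_sumr => i _.
have /memv_capP[viA /[!memv_ker]/eqP hv] := vA i isT.
rewrite memv_cap memvD ?memvZ ?memvB ?memvZ //= memv_ker pencilE.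
rewrite !(linearD, linearN, linearZ) /= hv hb.
by apply/eqP; rewrite /GRing.scale /=; ring.
Qed.

(* Every summand is lower semicontinuous, so at a maximizer of the sum each
   summand is constant along generic perturbations. *)
Definition genericity h : nat :=
  (\sum_e \sum_f \dim (A e + A f + trace_span h)%VS)%N.

Lemma generic_dim_spanE h g :
  crosses h ->
  (forall h', crosses h' -> (genericity h' <= genericity h)%N) ->
  generic (fun t => crosses (h + t *: g) /\ forall e f,
    \dim (A e + A f + trace_span (h + t *: g)%R)%VS
      = \dim (A e + A f + trace_span h)%VS).
Proof.
move=> hA maxh.
have /generic_and/(_ (generic_crosses g hA))[p p0 pP] :=
  generic_forall (fun e => generic_forall (fun f => generic_dim_span g e f hA)).
exists p => // t /pP[le_t hA_t]; split => // e f.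
have := maxh _ hA_t; rewrite leqNgt => /negP max_t.
apply/eqP; rewrite eqn_leq le_t andbT leqNgt; apply/negP => lt_ef; apply: max_t.
rewrite /genericity (bigD1 e) //= (bigD1 f) //=.
rewrite [X in (_ < X)%N](bigD1 e) //= [X in (_ < X + _)%N](bigD1 f) //=.
rewrite -!addnA -addSn leq_add // leq_add //.
  by apply: leq_sum => k _; exact: le_t.
by apply: leq_sum => k _; apply: leq_sum => l _; exact: le_t.
Qed.

(** Rephrases coincidence of two such lines through the dimensions that enter [genericity], so that
    generic perturbations preserve it. *)
Lemma same_span h e f : crosses h ->
  ((A e + trace_span h)%VS == (A f + trace_span h)%VS) =
  (\dim (A e + A f + trace_span h)%VS == (\dim (trace_span h)).+1).
Proof.
move=> hA; set L := trace_span h.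
have sub1 : (A e + L <= A e + A f + L)%VS by rewrite addvS ?addvSl.
have sub2 : (A f + L <= A e + A f + L)%VS by rewrite addvS ?addvSr.
apply/eqP/eqP => [ef | dim_ef].
  by rewrite -addvA -ef addvA addvv dim_add_trace_span.
have -> : (A e + L = A e + A f + L)%VS.
  by apply/eqP; rewrite eqEdim sub1 dim_ef dim_add_trace_span /=.
by apply/esym/eqP; rewrite eqEdim sub2 dim_ef dim_add_trace_span /=.
Qed.

Definition span_classes h : {set {set E}} :=
  preim_partition (fun e => (A e + trace_span h)%VS) [set: E].

Lemma span_classesP h (F : {set E}) e f :
  F \in span_classes h -> e \in F ->
  (f \in F) = ((A e + trace_span h)%VS == (A f + trace_span h)%VS).
Proof.
by case/imsetP=> k _ ->; rewrite !inE /= => /eqP->.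
Qed.

Lemma class_trace_sub h (F : {set E}) :
  F \in span_classes h ->
  (((\sum_(e in F) A e) :&: lker h) <= trace_span h)%VS.
Proof.
move=> FP; have [-> | [f fF]] := set_0Vmem F.
  by rewrite big_set0 cap0v sub0v.
apply: (cap_lker_sub (trace_span_lker h) (trace_sub_span h f)).
apply/subv_sumP => e eF.
move: eF; rewrite (span_classesP e FP fF) => /eqP->; exact: addvSl.
Qed.

(** * Independence of the block traces at a maximizer *)

Hypothesis infK : forall Q : K -> Prop, generic Q -> exists t, Q t.

Lemma directv_class_traces h :
  crosses h ->
  (forall h', crosses h' -> (genericity h' <= genericity h)%N) ->
  directv (\sum_(F in span_classes h) ((\sum_(e in F) A e) :&: lker h)).
Proof.
move=> hA maxh; have parP := preim_partitionP (fun e => (A e + trace_span h)%VS) [set: E].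
apply: directv_functional => v F G g vC sum_v FP GP FG gF gG g0.
have nonempty (B : {set E}) : B \in span_classes h -> exists e, e \in B.
  move=> BP; apply/set0Pn; apply: contraTneq BP => ->.
  by case/and3P: parP.
have [e eF] := nonempty F FP; have [f fG] := nonempty G GP.
have [b bA hb] := unit_vector (hA e); have [c cA hc] := unit_vector (hA f).
have gen_b : generic (fun t => 1 + t * g b != 0).
  by apply: generic_linear_neq0; exact: oner_neq0.
have gen_c : generic (fun t => 1 + t * g c != 0).
  by apply: generic_linear_neq0; exact: oner_neq0.
have [t [[[hA_t dim_t] [tb tc]] t0]] := infK (generic_and (generic_and
  (generic_dim_spanE g hA maxh) (generic_and gen_b gen_c)) (generic_neq0 K)).
pose h' := h + t *: g.
have dimL : \dim (trace_span h') = \dim (trace_span h).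
  by apply: succn_inj; have := dim_t e e; rewrite addvv !dim_add_trace_span.
have spanE k l : ((A k + trace_span h')%VS == (A l + trace_span h')%VS) =
                 ((A k + trace_span h)%VS == (A l + trace_span h)%VS).
  by rewrite !same_span // dim_t dimL.
have classesE : span_classes h' = span_classes h.
  by apply: eq_imset => k; apply/setP => l; rewrite !inE /= spanE.
have sub_class B x : B \in span_classes h -> x \in (\sum_(k in B) A k)%VS ->
    h' x = 0 -> x \in trace_span h'.
  rewrite -classesE => BP xB h'x; apply: (subvP (class_trace_sub BP)).
  by rewrite memv_cap xB memv_ker h'x eqxx.
have vB B : B \in span_classes h -> v B \in (\sum_(k in B) A k)%VS /\ h (v B) = 0.
  by move=> /vC/memv_capP[? /[!memv_ker]/eqP].
(* Since [h'] is [-t] on [v F], [t] on [v G], [1 + t * g b] on [b] and [1 + t * g c] on [c], these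
   are the coefficients that put [v F + y *: b] and [v G - z *: c] in its kernel. *)
pose y := t / (1 + t * g b); pose z := t / (1 + t * g c).
have uF : v F + y *: b \in trace_span h'.
  have [vF hvF] := vB F FP; apply: (sub_class F) => //.
    by rewrite memvD ?memvZ // (subvP (sumv_sup e eF (subvv _))).
  rewrite linearD linearZ /= !pencilE hvF hb gF /y /GRing.scale /=; field; exact: tb.
have uG : v G - z *: c \in trace_span h'.
  have [vG hvG] := vB G GP; apply: (sub_class G) => //.
    by rewrite memvB ?memvZ // (subvP (sumv_sup f fG (subvv _))).
  rewrite linearB linearZ /= !pencilE hvG hc gG /z /GRing.scale /=; field; exact: tc.
(* The [v B] sum to zero, so only the two corrections remain; the other [v B] need none, being
   killed by both [h] and [g]. *)
have ybzc : y *: b - z *: c \in trace_span h'.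
  rewrite (_ : _ - _ = (v F + y *: b) + (v G - z *: c)
      + \sum_(B in span_classes h | (B != F) && (B != G)) v B); last first.
    move: sum_v; rewrite (bigD1 F) //= (bigD1 G) /=; last by rewrite GP eq_sym.
    under eq_bigl do rewrite -andbA.
    by move=> sum_v; rewrite addrACA [RHS]addrAC -(addrA (v F)) sum_v add0r.
  rewrite memvD ?(memvD uF uG) //; apply: memv_suml => B /and3P[BP BF BG].
  have [vBB hv] := vB B BP; apply: (sub_class B) => //.
  by rewrite pencilE hv g0 // mulr0 addr0.
have bAf : b \in (A f + trace_span h')%VS.
  have y0 : y != 0 by rewrite mulf_neq0 ?invr_eq0.
  rewrite -[b](scalerK y0) memvZ // -(subrK (z *: c) (y *: b)) addrC.
  by rewrite memv_add // memvZ.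
(* As [h' b] is nonzero, [A e] is spanned by [b] and its trace on the kernel of [h']; equal
   dimensions then turn this inclusion into equality. *)
have eAf : (A e + trace_span h' <= A f + trace_span h')%VS.
  rewrite subv_add addvSr andbT.
  apply: subv_trans (@sub_line_lker _ _ h' _ _ bA _) _; first by rewrite /h' pencilE hb.
  rewrite subv_add -memvE bAf /=.
  exact: subv_trans (trace_sub_span h' e) (addvSr _ _).
have /[!spanE] ef : (A e + trace_span h')%VS == (A f + trace_span h')%VS.
  by rewrite eqEdim eAf !dim_add_trace_span /=.
case/eqP: FG; apply/setP => k.
by rewrite (span_classesP k FP eF) (span_classesP k GP fG) (eqP ef).
Qed.

(** * Comparison with partition weights and conclusion *)

Lemma dim_block_trace h (P : {set {set E}}) (F : {set E}) :
  crosses h -> partition P [set: E] -> F \in P ->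
  \dim ((\sum_(e in F) A e) :&: lker h)%VS = (\dim (\sum_(e in F) A e)%VS - 1)%N.
Proof.
move=> hA /and3P[_ _ P0] FP; rewrite -(@dim_cap_lker _ _ h (\sum_(e in F) A e)%VS) ?subn1 //.
have [e eF] : exists e, e \in F by apply/set0Pn; apply: contraTneq FP => ->.
by apply: contra (hA e); apply: subv_trans; exact: (sumv_sup e).
Qed.

(** Each trace lies in the trace of its block, and the dimension of a sum is at most the sum of the
    dimensions. *)
Lemma dim_trace_span_le h (P : {set {set E}}) :
  crosses h -> partition P [set: E] ->
  (\dim (trace_span h) <= partition_weight A P)%N.
Proof.
move=> hA parP.
have sub : (trace_span h <= \sum_(F in P) ((\sum_(e in F) A e) :&: lker h))%VS.
  apply/subv_sumP => e _; have /and3P[/eqP covP _ _] := parP.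
  have ePb : e \in cover P by rewrite covP.
  apply: (sumv_sup (pblock P e)); first exact: pblock_mem.
  by apply: capvS => //; apply: (sumv_sup e); rewrite ?mem_pblock.
apply: leq_trans (dimvS sub) _; apply: leq_trans (dimv_leq_sum _ _ _) _.
by apply: leq_sum => F FP; rewrite (dim_block_trace hA parP FP).
Qed.

Lemma dim_trace_span_classes h :
  crosses h ->
  (forall h', crosses h' -> (genericity h' <= genericity h)%N) ->
  \dim (trace_span h) = partition_weight A (span_classes h).
Proof.
move=> hA maxh; have parP : partition (span_classes h) [set: E].
  exact: preim_partitionP.
apply/eqP; rewrite eqn_leq dim_trace_span_le //=.
have /directvP/= := directv_class_traces hA maxh.
rewrite (eq_bigr _ (fun F FP => dim_block_trace hA parP FP)) -/(partition_weight _ _) => <-.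
by apply/dimvS/subv_sumP => F; exact: class_trace_sub.
Qed.

Lemma codim1_lker (H : {vspace 'rV[K]_n}) :
  codim1 H -> exists h : 'Hom('rV[K]_n, K^o), H = lker h.
Proof.
move=> H1; have dimV : \dim {: 'rV[K]_n} = n by rewrite dimvf /dim /= mul1n.
have /subvPn[x _ xH] : ~~ ({: 'rV[K]_n} <= H)%VS.
  by apply/negP => /dimvS; rewrite dimV -[X in (X <= _)%N]H1 ltnn.
have [h defH hx] := separating_functional xH; exists h.
have subH : (H <= lker h)%VS by rewrite defH capvSr.
apply/eqP; rewrite eqEdim subH -ltnS [X in (_ < X)%N]H1 /= -[X in (_ < X)%N]dimV.
rewrite -(@dim_cap_lker _ _ h fullv) ?capfv //.
by apply/subvPn; exists x; rewrite ?memvf // memv_ker hx oner_neq0.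
Qed.

Lemma dim_regular_trace_min (H : {vspace 'rV[K]_n}) :
  regular_wrt A H ->
  is_min
    (fun w : nat => exists P : {set {set E}},
       partition P [set: E] /\ w = partition_weight A P)
    (\dim (\sum_e (A e :&: H))%VS).
Proof.
case=> /codim1_lker[h ->] trH maxH.
have hA : crosses h.
  by move=> e; apply/negP => /capv_idPl Ae; have := trH e; rewrite Ae => /eqP; rewrite gtn_eqF.
split; last by move=> _ [P [parP ->]]; exact: dim_trace_span_le.
have [|h1 _|h1 h1A maxh1] := @ex_maximizer _ crosses genericity (#|E| * (#|E| * n)).
- by exists h.
- apply: leq_trans (_ : (\sum_(e : E) \sum_(f : E) n <= _)%N).
    apply: leq_sum => e _; apply: leq_sum => f _.
    by rewrite (leq_trans (dimvS (subvf _))) // dimvf /dim /= mul1n.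
  by rewrite !sum_nat_const.
exists (span_classes h1); split; first exact: preim_partitionP.
have parP : partition (span_classes h1) [set: E] by exact: preim_partitionP.
(* The weight of the classes of [h1] is the dimension of [trace_span h1], which regularity, applied
   to the whole of [E], bounds by that of [trace_span h]. *)
apply/eqP; rewrite eqn_leq dim_trace_span_le //= -dim_trace_span_classes //.
(* For empty [E], [crosses h1] is vacuous and [h1] may be zero, so its kernel need not be a
   hyperplane; both spans are then zero. *)
have [e _ | noE] := pickP E; last by rewrite /trace_span big_pred0 // dimv0.
have := maxH [set: E] (lker h1); rewrite !(eq_bigl _ _ (@in_setT E)); apply.
- rewrite /codim1 -[lker h1]capfv (@dim_cap_lker _ _ h1) ?dimvf /dim /= ?mul1n //.
  by apply: contra (h1A e); apply: subv_trans; exact: subvf.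
- by move=> f; rewrite dim_cap_lker.
Qed.

End Traces.

Theorem theoremA2 (R : realType) (k : scalar_kind) (n : nat) (E : finType)
    (A : E -> {vspace 'rV[scalar_field R k]_n})
    (H : {vspace 'rV[scalar_field R k]_n})
    (A_nontrivial : forall e : E, A e <> 0%VS)
    (H_regular : regular_wrt A H) :
  is_min
    (fun w : nat => exists P : {set {set E}},
       partition P [set: E] /\ w = partition_weight A P)
    (\dim (\sum_(e : E) (A e :&: H))%VS).
Proof.
apply: dim_regular_trace_min => //.
by case: k {A H A_nontrivial H_regular} => Q /= /generic_ex.
Qed.
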